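(* Let $R$ be a commutative ring with identity. Then $R$ admits a $\prec$-minimal generator if and only if $R$ is (isomorphic to) a finite product of local rings. In this case, writing the strong minimal generator of $R$ as $\mathcal I=\{I_1,\dots,I_k\}$ (with $I_1,\dots,I_k$ pairwise distinct), the ring $R$ has exactly $k$ maximal ideals and: (1) each ideal $I_i$ in $\mathcal I$ is idempotent (i.e. $I_i^2=I_i$) and principal; (2) $\mathcal I$ is orthogonal, that is, $I_iI_j=0$ for $i\neq j$.
   Context: All rings are commutative with identity. A ring is local if it has a unique maximal ideal. A generator of $R$ is a finite set $\mathcal I$ of ideals of $R$ with $\sum_{I\in\mathcal I}I=R$. For families of sets $\mathcal A,\mathcal B$, write $\mathcal A\prec\mathcal B$ ($\mathcal A$ refines $\mathcal B$) if for every $A\in\mathcal A$ there is $B\in\mathcal B$ with $A\subseteq B$. A generator $\mathcal I$ is $\prec$-minimal if $\mathcal I\prec\mathcal J$ for every generator $\mathcal J$ of $R$. A generator is strong minimal if it is $\prec$-minimal and no proper subset of it is a generator; every $\prec$-minimal generator contains a strong minimal generator, and a strong minimal generator is unique when it exists. *)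

(* Defs.v *)
From HB Require Import structures.
From mathcomp Require Import all_boot all_order all_algebra.
From mathcomp Require Import boolp classical_sets functions cardinality.

Set Implicit Arguments.
Unset Strict Implicit.
Unset Printing Implicit Defensive.

Import GRing.Theory.

Local Open Scope classical_set_scope.
Local Open Scope ring_scope.

(* Rings are [comPzRingType]: commutative with identity, the zero ring allowed.
   Ideals are arbitrary subsets [set R]; the ideals of [ring_quotient] are
   proper by definition and so exclude R itself. *)

Definition is_ideal (R : comPzRingType) (I : set R) : Prop :=
  [/\ I 0,
      forall x y, I x -> I y -> I (x + y)
    & forall r x, I x -> I (r * x)].

(* The empty family has sum the zero ideal. *)
Definition ideal_sum (R : comPzRingType) (F : set (set R)) : set R :=
  [set x | exists2 s : seq R,
     {in s, forall a, exists2 I, F I & I a} & x = \sum_(a <- s) a].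

Definition ideal_mul (R : comPzRingType) (I J : set R) : set R :=
  [set x | exists2 s : seq (R * R),
     {in s, forall p, I p.1 /\ J p.2} & x = \sum_(p <- s) p.1 * p.2].

Definition idempotent_ideal (R : comPzRingType) (I : set R) : Prop :=
  ideal_mul I I = I.

Definition principal_ideal (R : comPzRingType) (I : set R) : Prop :=
  exists a : R, I = [set r * a | r in [set: R]].

Definition maximal_ideal (R : comPzRingType) (M : set R) : Prop :=
  [/\ is_ideal M, M <> [set: R]
    & forall J : set R, is_ideal J -> M `<=` J -> J = M \/ J = [set: R]].

Definition local_ring (R : comPzRingType) : Prop :=
  exists! M : set R, maximal_ideal M.

(* A map into the product ring (with componentwise operations) is a ring
   morphism exactly when each of its components is. *)
Definition finite_product_of_local_rings (R : comPzRingType) : Prop :=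
  exists (n : nat) (L : 'I_n -> comPzRingType)
         (f : forall i, {rmorphism R -> L i}),
    (forall i, local_ring (L i)) /\
    bijective (fun (x : R) (i : 'I_n) => f i x).

Definition generator (R : comPzRingType) (F : set (set R)) : Prop :=
  [/\ finite_set F, forall I, F I -> is_ideal I & ideal_sum F = [set: R]].

Definition refines (T : Type) (A B : set (set T)) : Prop :=
  forall X, A X -> exists2 Y, B Y & X `<=` Y.

Definition prec_minimal (R : comPzRingType) (F : set (set R)) : Prop :=
  generator F /\ forall G, generator G -> refines F G.

Definition strong_minimal (R : comPzRingType) (F : set (set R)) : Prop :=
  prec_minimal F /\ forall G, G `<` F -> ~ generator G.

(* Main.v *)
(* Call [e] local if whenever 1 is a finite sum, one of the summands divides [e].
   Elements of the ideals of a minimal generator are local, so 1 is a sum of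
   local elements. In a shortest such sum no term divides another one; applying
   locality to the sum of all products [a_p a_q], and then to 1 = f + (1 - f)
   with [f] an idempotent associate of a term, forces the terms to be orthogonal
   idempotents [e_i]. Their corners [e_i R] are the local factors, the ideals
   [e_i R] form the strong minimal generator, and the maximal ideals are the sets
   of elements not dividing a given [e_i]. Conversely, the unit of each local
   factor is local, because non-units lie in the maximal ideal. *)

From HB Require Import structures.
Require Import Defs.
From mathcomp Require Import all_boot all_order all_algebra.
From mathcomp Require Import boolp classical_sets functions cardinality.
From mathcomp Require Import ring.

Set Implicit Arguments.
Unset Strict Implicit.
Unset Printing Implicit Defensive.

Import GRing.Theory.

Local Open Scope classical_set_scope.
Local Open Scope ring_scope.

(** * The corner ring of an idempotent *)

Section Corner.
Variables (R : comPzRingType) (e : R).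

(** For idempotent [e] this is the ideal [e R]; the equation makes membership boolean, as the
    subtype requires. *)
Definition corner_pred : {pred R} := [pred x | x * e == x].

Lemma corner_zmod_closed : zmod_closed corner_pred.
Proof.
split=> [|x y /eqP xe /eqP ye]; first by rewrite inE mul0r.
by rewrite inE mulrBl xe ye.
Qed.

HB.instance Definition _ :=
  GRing.isZmodClosed.Build R corner_pred corner_zmod_closed.

(* The proof of idempotency is a parameter so that the ring structure on the
   corner ring [e R] can be inferred from its type. *)
Record corner (idem : e * e = e) : Type :=
  Corner { corner_val : R; corner_valP : corner_val \in corner_pred }.

Hypothesis idem : e * e = e.

HB.instance Definition _ := [isSub for @corner_val idem].
HB.instance Definition _ := [Choice of corner idem by <:].
HB.instance Definition _ := [SubChoice_isSubZmodule of corner idem by <:].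

Lemma corner_mem (x : R) : x * e \in corner_pred.
Proof. by rewrite inE -mulrA idem. Qed.

Definition to_corner (x : R) : corner idem := Corner idem (corner_mem x).

Lemma corner_mulr (c : corner idem) : val c * e = val c.
Proof. by have := valP c; rewrite inE => /eqP. Qed.

Definition corner_mul (c d : corner idem) := to_corner (val c * val d).

Lemma corner_mulA : associative corner_mul.
Proof. by move=> a b c; apply: val_inj => /=; ring. Qed.

Lemma corner_mulC : commutative corner_mul.
Proof. by move=> a b; apply: val_inj => /=; rewrite (mulrC (val a)). Qed.

Lemma corner_mul1r : left_id (to_corner 1) corner_mul.
Proof.
by move=> a; apply: val_inj; rewrite /= mul1r mulrAC idem mulrC corner_mulr.
Qed.

Lemma corner_mulDl : left_distributive corner_mul +%R.
Proof. by move=> a b c; apply: val_inj; rewrite /= !mulrDl. Qed.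

HB.instance Definition _ :=
  GRing.Zmodule_isComPzRing.Build (corner idem)
    corner_mulA corner_mulC corner_mul1r corner_mulDl.

Lemma to_corner_zmod_morphism : zmod_morphism to_corner.
Proof. by move=> x y; apply: val_inj; rewrite /= mulrBl. Qed.

Lemma to_corner_monoid_morphism : monoid_morphism to_corner.
Proof.
split=> // x y; apply: val_inj => /=.
by rewrite -!mulrA idem (mulrCA e) idem.
Qed.

HB.instance Definition _ :=
  GRing.isZmodMorphism.Build R (corner idem) to_corner to_corner_zmod_morphism.
HB.instance Definition _ :=
  GRing.isMonoidMorphism.Build R (corner idem) to_corner
    to_corner_monoid_morphism.

End Corner.

(** * Local elements and orthogonal decompositions of [1] *)

Section LocalDecomposition.
Variable R : comPzRingType.
Implicit Types (a e x : R) (I J M : set R) (s : seq R)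
  (F G : set (set R)).

Definition principal a : set R := [set r * a | r in [set: R]].

Lemma principalP a x : principal a x <-> exists r, x = r * a.
Proof. by split=> [[r _ <-]|[r ->]]; exists r. Qed.

Lemma principal_is_ideal a : is_ideal (principal a).
Proof.
split; first by exists 0; rewrite ?mul0r.
- by move=> _ _ [r _ <-] [t _ <-]; exists (r + t); rewrite ?mulrDl.
by move=> t _ [r _ <-]; exists (t * r); rewrite ?mulrA.
Qed.

Lemma principal_sub a I : is_ideal I -> I a -> principal a `<=` I.
Proof. by move=> [_ _ Imul] Ia _ [r _ <-]; apply: Imul. Qed.

Lemma principal_id a : principal a a.
Proof. by apply/principalP; exists 1; rewrite mul1r. Qed.

Lemma is_ideal_sum I s :
  is_ideal I -> {in s, forall x, I x} -> I (\sum_(x <- s) x).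
Proof. by move=> [I0 Iadd _] sI; rewrite big_seq; apply: big_ind. Qed.

Lemma is_ideal_eqT I : is_ideal I -> I 1 -> I = [set: R].
Proof.
move=> [_ _ Imul] I1; rewrite predeqE => x; split=> // _.
by rewrite -[x]mulr1; apply: Imul.
Qed.

(** Turns equations between elements into generators, so that minimality can be tested on
    elements. *)
Lemma generator_of_sum s :
  \sum_(x <- s) x = 1 -> generator (principal @` [set` s]).
Proof.
move=> s1; split.
- by apply: finite_image; apply/finite_seqP; exists s.
- by move=> _ [x _ <-]; apply: principal_is_ideal.
rewrite predeqE => y; split=> // _; exists [seq y * x | x <- s].
  move=> _ /mapP[x sx ->]; exists (principal x); first by exists x.
  by exists y.
by rewrite big_map -mulr_sumr s1 mulr1.
Qed.

Definition local_elt e :=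
  forall s, \sum_(x <- s) x = 1 -> exists2 x, x \in s & principal x e.

Lemma local_eltMl r e : local_elt e -> local_elt (r * e).
Proof.
move=> loc_e s /loc_e[x sx xe]; exists x => //.
by have [_ _] := principal_is_ideal x; apply.
Qed.

(** [F] refines the generator formed by the principal ideals of the terms of [s], so one of these
    contains all of [I]. *)
Lemma prec_minimal_local F I a : prec_minimal F -> F I -> I a -> local_elt a.
Proof.
move=> [_ Fmin] FI Ia s /generator_of_sum/Fmin/(_ _ FI)[_ [x sx <-] Ix].
by exists x => //; apply: Ix.
Qed.

Lemma prec_minimal_local_sum F : prec_minimal F ->
  exists n (a : 'I_n -> R),
    \sum_i a i = 1 /\ forall i, local_elt (a i).
Proof.
move=> Fmin; have [[_ _ Fsum] _] := Fmin.
have [s sF s1] : ideal_sum F 1 by rewrite Fsum.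
exists (size s), (tnth (in_tuple s)); split=> [|i].
  by rewrite s1 [RHS]big_tnth.
have [I FI Ia] := sF _ (mem_tnth i (in_tuple s)).
exact: prec_minimal_local Fmin FI Ia.
Qed.

(** Idempotency is automatic: multiply the sum by [e i]. The zero ring has the empty
    decomposition. *)
Definition local_decomposition n (e : 'I_n -> R) : Prop :=
  [/\ \sum_i e i = 1, forall i j, i != j -> e i * e j = 0,
      forall i, e i <> 0 & forall i, local_elt (e i)].

(* Take [b] of minimal length: a combination equal to 1 that omits [b i] would be
   a shorter sum of local elements. *)
Lemma minimal_local_sum n (a : 'I_n -> R) :
  \sum_i a i = 1 -> (forall i, local_elt (a i)) ->
  exists m (b : 'I_m -> R),
    [/\ \sum_i b i = 1, forall i, local_elt (b i)
      & forall (i : 'I_m) (c : 'I_m -> R), \sum_(k | k != i) c k * b k <> 1].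
Proof.
move=> a1 aloc.
pose P m := `[< exists b : 'I_m -> R,
  \sum_i b i = 1 /\ forall i, local_elt (b i) >].
have exP : exists m, P m by exists n; apply/asboolP; exists a.
case: (ex_minnP exP) => m /asboolP[b [b1 bloc]] m_min.
exists m, b; split=> // i c bc1.
have : P m.-1.
  apply/asboolP; exists (fun k => c (lift i k) * b (lift i k)); split.
    rewrite -bc1 [RHS]big_mkcond [RHS](bigD1_ord i) //= eqxx add0r.
    by apply: eq_bigr => k _; rewrite eq_sym neq_lift.
  by move=> k; apply: local_eltMl.
move/m_min; case: m i {b b1 bloc m_min c bc1} => [[]//|m] _.
by rewrite ltnn.
Qed.

Lemma exists_local_decomposition F : prec_minimal F ->
  exists n (e : 'I_n -> R), local_decomposition e.
Proof.
move=> /prec_minimal_local_sum[n [b [b1 bloc]]].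
have [m [a [a1 aloc amin]]] := minimal_local_sum b1 bloc.
exists m, a.
have a_indep i j : principal (a j) (a i) -> i = j.
  move=> /principalP[r air]; apply/eqP; apply/contraT => ij.
  (* As [a i = r * a j], raising the coefficient of [a j] to [1 + r] makes up for the omitted
     [a i]. *)
  case: (amin i (fun k => 1 + r * (k == j)%:R)).
  rewrite -[RHS]a1 [RHS](bigD1 i) //=.
  under eq_bigr do rewrite mulrDl mul1r.
  rewrite big_split /= addrC; congr (_ + _).
  rewrite (bigD1 j) 1?eq_sym //= eqxx mulr1 -air big1 ?addr0 // => k /andP[_].
  by move=> /negbTE ->; rewrite mulr0 mul0r.
have asqr i : exists r, a i = r * (a i * a i).
  (* Expanding [1 = 1 * 1] gives this sum; both factors of a product dividing [a i] divide [a i], so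
     both indices are [i]. *)
  have [|x] := aloc i [seq a p * a q | p <- enum 'I_m, q <- enum 'I_m].
    rewrite big_allpairs_dep /= big_enum /=.
    under eq_bigr do rewrite big_enum /= -mulr_sumr a1 mulr1.
    by rewrite a1.
  move=> /allpairsP[[p q] [_ _ ->]] /= /principalP[r air].
  have ip : i = p by apply: a_indep; exists (r * a q) => //; rewrite air; ring.
  have iq : i = q by apply: a_indep; exists (r * a p) => //; rewrite air; ring.
  by exists r; rewrite [LHS]air -ip -iq.
have orth i j : i != j -> a i * a j = 0.
  move=> ij; have [r ajr] := asqr j.
  (* [r * a j] is an idempotent associate of [a j]. It cannot divide [a i], so its complement does,
     and the complement kills [a j]. *)
  have [|x] := aloc i [:: r * a j; 1 - r * a j].
    by rewrite !big_cons big_nil addr0 addrC subrK.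
  rewrite !inE => /orP[] /eqP -> /principalP[y aiy].
    move/eqP: ij; case; apply: a_indep; exists (y * r) => //.
    by rewrite aiy mulrA.
  by rewrite aiy -mulrA mulrBl mul1r -mulrA -ajr subrr mulr0.
split=> // i ai0; apply: (amin i (fun=> 1)).
rewrite -[RHS]a1 [RHS](bigD1 i) //= ai0 add0r.
by under eq_bigr do rewrite mul1r.
Qed.

(** * Strong minimal generator and maximal ideals of a decomposition *)

Section Decomposition.
Variables (n : nat) (e : 'I_n -> R).
Hypothesis e_dec : local_decomposition e.

Let e_sum : \sum_i e i = 1. Proof. by case: e_dec. Qed.
Let e_orth i j : i != j -> e i * e j = 0.
Proof. by case: e_dec => _ + _ _; apply. Qed.
Let e_neq0 i : e i <> 0. Proof. by case: e_dec. Qed.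
Let e_local i : local_elt (e i). Proof. by case: e_dec. Qed.

Lemma decomposition_idem i : e i * e i = e i.
Proof.
rewrite -[RHS]mulr1 -e_sum mulr_sumr (bigD1 i) //= big1 ?addr0 // => j ji.
by rewrite e_orth // eq_sym.
Qed.

Lemma decomposition_dvd_eq i j : principal (e j) (e i) -> i = j.
Proof.
move=> /principalP[r eir]; apply/eqP/contraT => ij; case: (@e_neq0 i).
by rewrite -decomposition_idem {1}eir -mulrA e_orth ?mulr0 // eq_sym.
Qed.

Definition components : set (set R) :=
  [set principal (e i) | i in [set: 'I_n]].

Lemma components_inj : injective (fun i => principal (e i)).
Proof.
move=> i j eq_ij; apply: decomposition_dvd_eq.
by rewrite -eq_ij; apply: principal_id.
Qed.

Lemma components_generator : generator components.
Proof.
split; first exact: finite_image.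
  by move=> _ [i _ <-]; apply: principal_is_ideal.
have [|_ _ <-] := @generator_of_sum [seq e i | i <- enum 'I_n].
  by rewrite big_map big_enum.
congr ideal_sum; rewrite predeqE => J; split=> [[i _ <-]|[x xe <-]].
  by exists (e i) => //=; apply: map_f; rewrite mem_enum.
by move/mapP: xe => [i _ ->]; exists i.
Qed.

(** Write [1] as a sum of elements of members of [G]: by locality one term divides [e i], so the
    member containing it contains [e i]. *)
Lemma components_refines G : generator G -> refines components G.
Proof.
move=> [_ Gid Gsum] _ [i _ <-].
have [s sG s1] : ideal_sum G 1 by rewrite Gsum.
have [x sx /principalP[r eir]] := e_local i (esym s1).
have [J GJ Jx] := sG x sx; exists J => //.
apply: principal_sub (Gid J GJ) _; rewrite eir.
by have [_ _] := Gid J GJ; apply.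
Qed.

Lemma components_antichain I J :
  components I -> components J -> I `<=` J -> I = J.
Proof.
move=> [i _ <-] [j _ <-] sub; congr (principal (e _)).
by apply: decomposition_dvd_eq; apply: sub; apply: principal_id.
Qed.

Lemma components_unique_strong_minimal : unique (@strong_minimal R) components.
Proof.
have cmin : prec_minimal components.
  by split; [exact: components_generator | exact: components_refines].
split.
  (* A generating subset is refined by [components], hence contains each of them by the antichain
     property. *)
  split=> // G [Gsub nsub] Ggen; apply: nsub => I cI.
  have [J GJ IJ] := components_refines Ggen cI.
  by rewrite (components_antichain cI (Gsub _ GJ) IJ).
move=> F [[Fgen Fmin] Fstrong].
(* Refinement both ways squeezes a member [J] of [F] between two components, which must coincide. *)
have sub : components `<=` F.
  move=> I cI; have [J FJ IJ] := components_refines Fgen cI.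
  have [K cK JK] := Fmin _ components_generator J FJ.
  have IK := components_antichain cI cK (subset_trans IJ JK).
  by suff -> : I = J by []; apply/seteqP; split; rewrite // IK.
apply/seteqP; split=> //; apply: contrapT => nsub.
exact: Fstrong (conj sub nsub) components_generator.
Qed.

(** The elements whose image in the corner of [e i] is not a unit, that is, the preimage of the
    maximal ideal of that local factor. *)
Definition component_maximal i : set R := [set x | ~ principal x (e i)].

Lemma component_maximal_ideal i :
  maximal_ideal (component_maximal i).
Proof.
have Mi1e : component_maximal i (1 - e i).
  move=> /principalP[y eiy]; apply: (@e_neq0 i).
  rewrite -decomposition_idem {1}eiy -mulrA mulrBl decomposition_idem.
  by rewrite mul1r subrr mulr0.
have Midl : is_ideal (component_maximal i).
  split.
  - by move=> /principalP[y]; rewrite mulr0; apply: e_neq0.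
  - move=> x y Mx My /principalP[r eir].
    (* Since [e i = r * (x + y)], these terms sum to [1]; the last does not divide [e i], so [x] or
       [y] would. *)
    have [|z] := @e_local i [:: r * x; r * y; 1 - e i].
      by rewrite !big_cons big_nil eir; ring.
    rewrite !inE => /or3P[] /eqP -> // /principalP[t eit].
      by apply: Mx; apply/principalP; exists (t * r); rewrite eit mulrA.
    by apply: My; apply/principalP; exists (t * r); rewrite eit mulrA.
  - move=> r x Mx /principalP[y eiy]; apply: Mx.
    by apply/principalP; exists (y * r); rewrite eiy mulrA.
split=> //.
  move=> MT; have : component_maximal i (e i) by rewrite MT.
  by case; apply: principal_id.
(* [J] contains [1 - e i], so it is everything once it contains [e i]; otherwise none of its
   elements divides [e i]. *)
move=> J Jid MJ; have [Jei|nJei] := pselect (J (e i)).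
  right; apply: is_ideal_eqT => //; rewrite -(subrK (e i) 1).
  by have [_ Jadd _] := Jid; apply: Jadd => //; apply: MJ.
left; apply/seteqP; split=> // x Jx /principalP[y eiy]; apply: nJei.
by rewrite eiy; have [_ _] := Jid; apply.
Qed.

(** A proper ideal misses some [e i], as they sum to [1]; none of its elements divides that [e i],
    and maximality gives equality. *)
Lemma maximal_component M :
  maximal_ideal M -> exists i, M = component_maximal i.
Proof.
move=> [Mid MnT Mmax].
have [i nMi] : exists i, ~ M (e i).
  apply/not_existsP => Me; apply: MnT; apply: is_ideal_eqT => //.
  rewrite -e_sum; have [M0 Madd _] := Mid; apply: big_ind => // i _.
  by apply: contrapT; apply: Me.
exists i; have [Cid CnT _] := component_maximal_ideal i.
have MC : M `<=` component_maximal i.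
  move=> x Mx /principalP[y eiy]; apply: nMi; rewrite eiy.
  by have [_ _] := Mid; apply.
by have [|/CnT] := Mmax _ Cid MC.
Qed.

Lemma component_maximal_inj : injective component_maximal.
Proof.
move=> i j Mij; apply: esym; apply: decomposition_dvd_eq.
have : ~ component_maximal i (e i) by move/(_ (@principal_id _)).
by rewrite Mij => /contrapT.
Qed.

Lemma card_maximal_ideals : ([set M : set R | maximal_ideal M] #= `I_n)%card.
Proof.
have -> : [set M : set R | maximal_ideal M] = component_maximal @` [set: 'I_n].
  rewrite predeqE => M; split=> [/maximal_component[i ->]|[i _ <-]].
    by exists i.
  exact: component_maximal_ideal.
apply: (card_eq_trans _ (card_esym card_II)).
apply: inj_card_eq => i j _ _; exact: component_maximal_inj.
Qed.

Lemma component_idempotent i : idempotent_ideal (principal (e i)).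
Proof.
rewrite /idempotent_ideal; apply/seteqP; split.
  move=> _ [s sI ->]; rewrite big_seq.
  have [I0 Iadd Imul] := principal_is_ideal (e i).
  by apply: big_ind => // p /sI[_ /Imul]; apply.
move=> x xI; exists [:: (x, e i)].
  by move=> p; rewrite inE => /eqP ->; split=> //; apply: principal_id.
rewrite big_seq1 /=; have /principalP[r ->] := xI.
by rewrite -mulrA decomposition_idem.
Qed.

Lemma components_orthogonal i j :
  i <> j -> ideal_mul (principal (e i)) (principal (e j)) = [set 0].
Proof.
move=> /eqP ij; apply/seteqP; split.
  move=> _ [s sI ->]; rewrite big_seq big1 // => p.
  move=> /sI[/principalP[r ->] /principalP[t ->]].
  by rewrite mulrACA e_orth ?mulr0.
by move=> _ ->; exists [::]; rewrite ?big_nil.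
Qed.

End Decomposition.

(** * Local rings and locality of [1] *)

Lemma local_ring_of_local1 : (1 : R) <> 0 -> local_elt 1 -> local_ring R.
Proof.
(* [1] alone is a decomposition with one index, hence with one maximal ideal. *)
move=> R1 loc1; pose e (_ : 'I_1) : R := 1.
have dec : local_decomposition e.
  by split=> //; [rewrite big_ord1 | move=> i j; rewrite !ord1].
exists (component_maximal e ord0); split; first exact: component_maximal_ideal.
by move=> M /(maximal_component dec)[i ->]; rewrite ord1.
Qed.

(** Krull's theorem, by Zorn's lemma on the ideals containing [x] but not [1]. *)
Lemma nonunit_maximal_ideal x :
  ~ principal x 1 -> exists2 M, maximal_ideal M & M x.
Proof.
move=> x1.
(* [set0] is allowed in [P] because it is the union of the empty chain. *)
pose P (A : set R) := A = set0 \/ [/\ is_ideal A, A x & ~ A 1].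
have [|A [PA Amax]] := @Zorn_bigcup R P.
  move=> C CP Ctot; have [C0|] := pselect (C `<=` [set set0]).
    left; rewrite -subset0 => y [X /C0 -> //].
  move=> /existsNP[A /not_implyP[CA A0]]; right.
  have idl X y : C X -> X y -> [/\ is_ideal X, X x & ~ X 1].
    by move=> /CP[-> //|].
  have [y Ay] : exists y, A y by apply/set0P/eqP.
  have [[A0' _ _] Ax _] := idl _ _ CA Ay; split; last first.
  - by move=> [X CX X1]; have [] := idl _ _ CX X1.
  - by exists A.
  split; first by exists A.
    move=> u v [X CX Xu] [Y CY Yv].
    have [XY|YX] := Ctot X Y CX CY.
      exists Y => //; have [[_ Yadd _] _ _] := idl _ _ CY Yv.
      by apply: Yadd => //; apply: XY.
    exists X => //; have [[_ Xadd _] _ _] := idl _ _ CX Xu.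
    by apply: Xadd => //; apply: YX.
  move=> r u [X CX Xu]; exists X => //.
  by have [[_ _ Xmul] _ _] := idl _ _ CX Xu; apply: Xmul.
have Pprinc : P (principal x).
  by right; split=> //; [exact: principal_is_ideal | exact: principal_id].
have [Aid Ax A1] : [/\ is_ideal A, A x & ~ A 1].
  (* The empty set is not maximal: [principal x] satisfies [P] and is strictly larger. *)
  case: PA => // A0; case: (Amax _ _ Pprinc); rewrite A0.
  by split=> // /(_ x (principal_id x)).
exists A => //; split=> //; first by move=> AT; apply: A1; rewrite AT.
move=> J Jid AJ; have [J1|nJ1] := pselect (J 1).
  by right; apply: is_ideal_eqT.
left; apply/seteqP; split=> //; apply: contrapT => JA.
by apply: (Amax J) => //; right; split=> //; apply: AJ.
Qed.

(** If no term were a unit, all would lie in the unique maximal ideal, and so would their sum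
    [1]. *)
Lemma local_ring_local1 : local_ring R -> local_elt 1.
Proof.
move=> [M [[Mid MnT _] Muniq]] s s1; apply: contrapT => ns.
apply: MnT; apply: is_ideal_eqT => //; rewrite -s1.
apply: is_ideal_sum => // x sx.
have [|N Nmax Nx] := @nonunit_maximal_ideal x; last by rewrite (Muniq N).
by move=> x1; apply: ns; exists x.
Qed.

Lemma local_ring_neq0 : local_ring R -> (1 : R) <> 0.
Proof.
move=> [M [[Mid MnT _] _]] R10; apply: MnT; apply: is_ideal_eqT => //.
by rewrite R10; case: Mid.
Qed.

End LocalDecomposition.

(** * Decompositions and products of local rings *)

Lemma decomposition_of_product (R : comPzRingType) :
  finite_product_of_local_rings R ->
  exists n (e : 'I_n -> R), local_decomposition e.
Proof.
move=> [n [L [f [Lloc [g fK gK]]]]].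
have fg h i : f i (g h) = h i.
  by move/(congr1 (fun k : forall i, L i => k i)): (gK h).
have f_inj x y : (forall i, f i x = f i y) -> x = y.
  move=> fxy; rewrite -(fK x) -(fK y); congr g.
  exact: functional_extensionality_dep.
(* The preimages of the unit vectors of the product. *)
pose e i : R := g (fun j => (i == j)%:R).
have fe i j : f j (e i) = (i == j)%:R by rewrite fg.
exists n, e; split.
- apply: f_inj => j; rewrite rmorph_sum rmorph1 (bigD1 j) //= fe eqxx.
  by rewrite big1 ?addr0 // => i /negbTE ij; rewrite fe ij.
- move=> i j ij; apply: f_inj => k; rewrite rmorphM rmorph0 !fe.
  by have [<-|] := eqVneq j k; rewrite ?(negbTE ij) ?mul0r ?mulr0.
- move=> i /(congr1 (f i)); rewrite fe eqxx rmorph0.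
  exact: local_ring_neq0.
- move=> i s s1.
  have [|_ /mapP[x sx ->] /principalP[z z1]] :=
      @local_ring_local1 (L i) (Lloc i) [seq f i x | x <- s].
    by rewrite big_map -rmorph_sum s1 rmorph1.
  (* [z] inverts the [i]-th component of [x]; extended by zero and lifted to [R], it is the cofactor
     of [x] in [e i]. *)
  exists x => //; apply/principalP; exists (g (@dfwith _ L (fun=> 0) i z)).
  apply: f_inj => j; rewrite fe rmorphM fg.
  by case: dfwithP => [|k ik]; rewrite ?eqxx -?z1 // (negbTE ik) mul0r.
Qed.

Lemma corner_val_sum (R : comPzRingType) (e : R) (idem : e * e = e)
  (I : Type) (s : seq I) (c : I -> corner idem) :
  val (\sum_(i <- s) c i) = \sum_(i <- s) val (c i).
Proof. by apply: (big_morph val) => //. Qed.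

Lemma corner_local (R : comPzRingType) (e : R) (idem : e * e = e) :
  e <> 0 -> local_elt e -> local_ring (corner idem).
Proof.
move=> e0 eloc; apply: local_ring_of_local1.
  by move=> /(congr1 val); rewrite /= mul1r.
(* A sum equal to [1] in the corner has value [e] in [R], and [1 - e] completes it to [1]. That
   extra term kills [e], so it cannot divide [e]. *)
move=> s s1; have [|x] := eloc (1 - e :: [seq val c | c <- s]).
  rewrite big_cons big_map -corner_val_sum s1 /= mul1r subrK //.
rewrite inE => /orP[/eqP ->|/mapP[c sc ->]] /principalP[y ey].
  case: e0; rewrite -idem {1}ey -mulrA mulrBl idem mul1r subrr mulr0 //.
exists c => //; apply/principalP; exists (to_corner idem y).
by apply: val_inj; rewrite /= mul1r (mulrAC y) -ey !idem.
Qed.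

Lemma product_of_decomposition (R : comPzRingType) n (e : 'I_n -> R) :
  local_decomposition e -> finite_product_of_local_rings R.
Proof.
move=> e_dec; pose idem := decomposition_idem e_dec.
have [e1 orth e0 eloc] := e_dec.
exists n, (fun i => corner (idem i)), (fun i => to_corner (idem i)).
split; first by move=> i; apply: corner_local.
(* The inverse adds up the components in [R]; multiplying by [e i] recovers the [i]-th one, by
   orthogonality. *)
exists (fun h : forall i, corner (idem i) => \sum_i val (h i)) => [x|h] /=.
  by rewrite -mulr_sumr e1 mulr1.
apply: functional_extensionality_dep => i; apply: val_inj => /=.
rewrite mulr_suml (bigD1 i) //= corner_mulr big1 ?addr0 // => j ji.
by rewrite -corner_mulr -mulrA orth ?mulr0.
Qed.

Theorem theorem3p2 (R : comPzRingType) :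
  ((exists F : set (set R), prec_minimal F) <->
     finite_product_of_local_rings R) /\
  ((exists F : set (set R), prec_minimal F) ->
     exists (k : nat) (I : 'I_k -> set R),
       [/\ injective I,
           unique (@strong_minimal R) [set I i | i in [set: 'I_k]],
           ([set M : set R | maximal_ideal M] #= `I_k)%card,
           forall i, idempotent_ideal (I i) /\ principal_ideal (I i)
         & forall i j, i <> j -> ideal_mul (I i) (I j) = [set 0]]).
Proof.
split; first split.
- move=> [F /exists_local_decomposition[n [e /product_of_decomposition]]] //.
- move=> /decomposition_of_product[n [e]].
  by move=> /components_unique_strong_minimal[[cmin _] _]; exists (components e).
move=> [F /exists_local_decomposition[n [e e_dec]]].
exists n, (fun i => principal (e i)); split.
- exact: components_inj.
- exact: components_unique_strong_minimal.
- exact: card_maximal_ideals e_dec.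
- by move=> i; split; [exact: component_idempotent | exists (e i)].
- exact: components_orthogonal.
Qed.
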